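(* Let $U$ be a random variable uniformly distributed on $[0,1]$. As $n\to\infty$, the random variable $Z_n=\big(U^n+(1-U)^n\big)^{1/n}$ converges almost surely to $Z_{\infty}=\max\{U,1-U\}$. *)

(* Defs.v *)
From HB Require Import structures.
From mathcomp Require Import all_boot all_order all_algebra.
From mathcomp Require Import all_classical all_reals all_analysis measurable_realfun.
Set Implicit Arguments.
Unset Strict Implicit.
Unset Printing Implicit Defensive.
Import Order.TTheory GRing.Theory Num.Theory.
Import numFieldNormedType.Exports.
Local Open Scope classical_set_scope.
Local Open Scope ring_scope.

(* The set functions are compared on measurable sets only: their values on
   non-measurable sets carry no meaning. *)
Definition uniform01 d (T : measurableType d) (R : realType)
    (P : probability T R) (U : {RV P >-> R}) : Prop :=
  forall A, measurable A ->
    distribution P U A = uniform_prob (@ltr01 R) A.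

Arguments uniform01 {d T R} P U.

Section random_variables.
Context d (T : measurableType d) (R : realType) (P : probability T R).

(* For n = 0 the exponent is 0^-1 = 0. *)
Definition Z_ (U : {RV P >-> R}) (n : nat) : T -> R :=
  fun w => (U w ^+ n + (1 - U w) ^+ n) `^ (n%:R^-1).

Definition Zoo (U : {RV P >-> R}) : T -> R :=
  fun w => Num.max (U w) (1 - U w).

Let measurable_Z_ (U : {RV P >-> R}) n : measurable_fun [set: T] (Z_ U n).
Proof.
apply: (measurableT_comp (measurable_powR _)).
by apply: measurable_funD; apply: measurable_funX => //; apply: measurable_funB.
Qed.

HB.instance Definition _ (U : {RV P >-> R}) n :=
  isMeasurableFun.Build _ _ _ _ (Z_ U n) (measurable_Z_ U n).

Let measurable_Zoo (U : {RV P >-> R}) : measurable_fun [set: T] (Zoo U).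
Proof. by apply: measurable_maxr => //; apply: measurable_funB. Qed.

HB.instance Definition _ (U : {RV P >-> R}) :=
  isMeasurableFun.Build _ _ _ _ (Zoo U) (measurable_Zoo U).

Definition as_cvg (X : nat -> {RV P >-> R}) (Y : {RV P >-> R}) : Prop :=
  {ae P, forall w, X n w @[n --> \oo] --> Y w}.

End random_variables.

Arguments as_cvg {d T R} P X Y.

(* Main.v *)
Require Import Defs.
From mathcomp Require Import all_boot all_order all_algebra.
From mathcomp Require Import all_classical all_reals all_analysis.
Import Order.TTheory GRing.Theory Num.Theory.
Import numFieldNormedType.Exports.
Local Open Scope classical_set_scope.
Local Open Scope ring_scope.

(** For a point [u] of [[0, 1]] the number [(u ^+ n + (1 - u) ^+ n) `^ n^-1] is
the [l^n] norm of the pair [(u, 1 - u)], and [l^n] norms tend to the sup norm: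
with [M = max x y] one has [M ^+ n <= x ^+ n + y ^+ n <= 2 * M ^+ n], so taking
[n]-th roots squeezes the norm between [M] and [2 `^ n^-1 * M]
([le_max_root_sum_expr], [root_sum_expr_le_max]), and the factor [2 `^ n^-1]
tends to 1 ([cvg_powR_invn]).  This gives convergence at every outcome where
[U] lies in [[0, 1]].

Uniformity serves to discard the other outcomes: the law of [U] has a
density that vanishes off [[0, 1]], so [U] lies in [[0, 1]] almost surely
([uniform01_ae_itv]). *)

Section max_as_limit_of_power_sums.
Context {R : realType}.
Implicit Types (a x y : R) (n : nat).

Lemma exprK_powR x n : 0 <= x -> (0 < n)%N -> (x ^+ n) `^ n%:R^-1 = x.
Proof.
move=> x0 n0; rewrite -powR_mulrn// -powRrM mulfV ?pnatr_eq0 -?lt0n//.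
by rewrite powRr1.
Qed.

(** Since [a `^ t = expR (t * ln a)], this is continuity of [expR] at 0. *)
Lemma cvg_powR_invn a : 0 < a -> a `^ n%:R^-1 @[n --> \oo] --> (1 : R).
Proof.
move=> a0.
have -> : (fun n => a `^ n%:R^-1) = (fun n => expR (n%:R^-1 * ln a)).
  by apply/funext => n; rewrite /powR gt_eqF.
rewrite -[X in _ --> X]expR0; apply: (@continuous_cvg _ _ _ _ _ _ expR).
  exact: continuous_expR.
rewrite -[X in _ --> X](mul0r (ln a)); apply: cvgMl.
(* [harmonic] is the sequence of the inverses of the [n.+1]. *)
rewrite -(cvg_shiftS (fun n => n%:R^-1 : R)); exact: cvg_harmonic.
Qed.

(** Each of [x ^+ n] and [y ^+ n] is below the sum because the other one is
nonnegative, and taking [n]-th roots is monotone. *)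
Lemma le_max_root_sum_expr x y n : 0 <= x -> 0 <= y -> (0 < n)%N ->
  Num.max x y <= (x ^+ n + y ^+ n) `^ n%:R^-1.
Proof.
move=> x0 y0 n0.
have root_le z : 0 <= z -> z ^+ n <= x ^+ n + y ^+ n ->
    z <= (x ^+ n + y ^+ n) `^ n%:R^-1.
  move=> z0 zxy; rewrite -{1}(exprK_powR _ _ z0 n0).
  by apply: ge0_ler_powR => //; rewrite ?nnegrE ?addr_ge0 ?exprn_ge0.
by rewrite ge_max !root_le ?lerDl ?lerDr ?exprn_ge0.
Qed.

Lemma root_sum_expr_le_max x y n : 0 <= x -> 0 <= y -> (0 < n)%N ->
  (x ^+ n + y ^+ n) `^ n%:R^-1 <= 2 `^ n%:R^-1 * Num.max x y.
Proof.
move=> x0 y0 n0; have M0 : 0 <= Num.max x y by rewrite le_max x0.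
rewrite -{1}(exprK_powR _ _ M0 n0) -powRM ?exprn_ge0//.
apply: ge0_ler_powR; rewrite ?nnegrE ?addr_ge0 ?mulr_ge0 ?exprn_ge0//.
by rewrite mulr_natl mulr2n lerD// lerXn2r ?nnegrE// le_max lexx ?orbT.
Qed.

Lemma cvg_root_sum_expr x y : 0 <= x -> 0 <= y ->
  (x ^+ n + y ^+ n) `^ n%:R^-1 @[n --> \oo] --> Num.max x y.
Proof.
move=> x0 y0; pose M := Num.max x y.
apply: (@squeeze_cvgr _ _ _ _ (fun=> M) (fun n => 2 `^ n%:R^-1 * M)).
(* At [n = 0] the exponent is [0^-1 = 0] and the root is 1, so the bounds are
   only claimed from [n = 1] on. *)
- exists 1%N => // n /= n0.
  by rewrite le_max_root_sum_expr// root_sum_expr_le_max.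
- exact: cvg_cst.
- rewrite -[X in _ --> X]mul1r; apply: cvgMl.
  exact: cvg_powR_invn.
Qed.

End max_as_limit_of_power_sums.

(** The exceptional set is the preimage of the complement of [[0, 1]], whose
measure is the integral of the uniform density over a set on which that density
vanishes. *)
Lemma uniform01_ae_itv {d : measure_display} {T : measurableType d}
    {R : realType} {P : probability T R} {U : {RV P >-> R}} :
  uniform01 P U -> {ae P, forall w, 0 <= U w <= 1}.
Proof.
move=> hU; exists (U @^-1` ~` `[0, 1]); split.
- rewrite -[X in measurable X]setTI.
  by apply: measurable_funP => //; exact: measurableC.
- have := hU (~` `[0, 1]) (measurableC (measurable_itv _)).
  rewrite /distribution /pushforward => ->.
  by rewrite /uniform_prob integral_uniform_pdf setICl integral_set0.
- by move=> w /=; rewrite in_itv.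
Qed.

Theorem corollary3 (d : measure_display) (T : measurableType d) (R : realType)
    (P : probability T R) (U : {RV P >-> R}) (hU : uniform01 P U) :
  as_cvg P (fun n => Z_ U n) (Zoo U).
Proof.
apply: filterS (uniform01_ae_itv hU) => w /andP[U0 U1].
by apply: cvg_root_sum_expr; rewrite ?subr_ge0.
Qed.
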